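(* Let $S=(X,X_0,f)$ be a transition system with $X_0=X\subset\mathbb{R}^n$ that is incrementally uniformly bounded ($\delta$-UB) and has an asymptotically stable equilibrium $x^*$, where $X$ is a compact subset of the region of attraction of $x^*$. Then for every resolution function $\epsilon:X\to\mathbb{R}_{>0}$ (depending on the abstract state), with associated resolution relation $$\overline{R}=\{(x,\hat x)\in X\times X : d(x,\hat x)\le \epsilon(\hat x)\},$$ there exist a finite-state deterministic abstraction $\hat S=(\hat X,\hat X_0,\hat f)$ of $S$ and a relation $R\subseteq X\times\hat X$ that is a multi-resolution approximate bisimulation relation between $S$ and $\hat S$ with resolution $\overline{R}$.
   Context: Transition system: a tuple $S=(X,X_0,f)$ with $X_0\subseteq X\subset\mathbb{R}^n$ and $f:X\to X$; $f^k$ denotes the $k$-fold composition of $f$. $X$ carries a metric $d$, and topological notions on $X$ are with respect to $d$. $\delta$-UB: $S$ is $\delta$-UB if there is a class $\mathcal{K}$ function $\alpha$ (i.e. $\alpha:\mathbb{R}_{\ge0}\to\mathbb{R}_{\ge0}$ continuous, strictly increasing, $\alpha(0)=0$) such that for all $x_0,x_0'\in X_0$ and all $k\in\mathbb{N}$, $d(x_k,x_k')\le\alpha(d(x_0,x_0'))$, where $x_k=f^k(x_0)$ and $x_k'=f^k(x_0')$. Equilibrium and region of attraction: $x^*$ is an equilibrium if $f(x^* )=x^*$; it is asymptotically stable in the usual (Lyapunov stable and locally attractive) sense; its region of attraction is the set of $x$ with $\lim_{k\to\infty} f^k(x)=x^*$. Quantiser and deterministic abstraction: let $\hat X\subseteq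 X$ be a finite collection of $k\in\mathbb{N}$ elements of $X$. A quantiser is any function $\kappa:X\to\hat X$. The deterministic abstraction of $S$ given by $\kappa$ is the transition system $\hat S=(\hat X,\hat X_0,\hat f)$ with $\hat X_0=\{\hat x\in\hat X:\exists x\in X_0,\ \hat x=\kappa(x)\}$ and $\hat f:\hat X\to\hat X$, $\hat f(\hat x)=\kappa(f(\hat x))$. Multi-resolution approximate bisimulation: $R\subseteq X\times\hat X$ is a multi-resolution approximate bisimulation relation between $S$ and $\hat S$ with resolution $\overline{R}$ if (1) for all $x\in X_0$ there exists $\hat x\in\hat X_0$ with $(x,\hat x)\in R$; (2) for all $(x,\hat x)\in R$, $(f(x),\hat f(\hat x))\in R$; (3) $R\subseteq\overline{R}$; (4) for all $\hat x\in\hat X_0$ there exists $x\in X_0$ with $(x,\hat x)\in R$. *)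

(* Defs.v *)
From HB Require Import structures.
From mathcomp Require Import all_boot all_order all_algebra.
From mathcomp Require Import all_classical all_reals all_analysis.

Set Implicit Arguments.
Unset Strict Implicit.
Unset Printing Implicit Defensive.

Import Order.TTheory GRing.Theory Num.Theory.
Import numFieldNormedType.Exports.

Local Open Scope classical_set_scope.
Local Open Scope ring_scope.

(* A set [X : set T] coerces to the type of its elements ([set_type]), so that
   [init] is a subset of [state] and [trans] is a map from [state] to itself. *)
Record transition_system (T : Type) := TransitionSystem {
  state : set T;
  init : set state;
  trans : state -> state }.

Arguments init {T} S : rename.
Arguments trans {T} S : rename.

Record metric (R : realType) (X : choiceType) := Metric {
  dist :> X -> X -> R;
  distxx : forall x, dist x x = 0;
  dist_eq0 : forall x y, dist x y = 0 -> x = y;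
  dist_sym : forall x y, dist x y = dist y x;
  dist_triangle : forall y x z, dist x z <= dist x y + dist y z }.

(* [X] with the topology of the metric [d]. When [X] is a [set_type] over
   ['rV[R]_n], the type [X] itself already carries the topology inherited from
   ['rV[R]_n], which an arbitrary metric on [X] need not induce. *)
Definition metric_space (R : realType) (X : choiceType) (d : metric R X) : Type :=
  X.

HB.instance Definition _ (R : realType) (X : choiceType) (d : metric R X) :=
  Choice.on (metric_space d).
HB.instance Definition _ (R : realType) (X : choiceType) (d : metric R X) :=
  @isMetric.Build R (metric_space d) (dist d)
    (distxx d) (@dist_eq0 _ _ d) (dist_sym d) (dist_triangle d).

Definition compact_for (R : realType) (X : choiceType) (d : metric R X)
    (A : set X) : Prop :=
  compact (A : set (metric_space d)).

(* Functions from [0, +oo[ to itself are represented by functions on [R], of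
   which only the restriction to [0, +oo[ matters; nonnegativity of the values
   on [0, +oo[ follows from the last two conditions. *)
Definition class_K (R : realType) (alpha : R -> R) : Prop :=
  [/\ {within `[0, +oo[, continuous alpha},
      {in `[0, +oo[ &, {homo alpha : s t / s < t}}
    & alpha 0 = 0].

Definition incrementally_uniformly_bounded (R : realType) (T : choiceType)
    (S : transition_system T) (d : metric R (state S)) : Prop :=
  exists2 alpha : R -> R, class_K alpha &
    forall x y : state S, init S x -> init S y ->
    forall k, d (iter k (trans S) x) (iter k (trans S) y) <= alpha (d x y).

Arguments incrementally_uniformly_bounded {R T} S d.

Section Equilibria.
Context (R : realType) (X : choiceType) (d : metric R X) (f : X -> X).

Definition region_of_attraction (xs : X) : set X :=
  [set x | (fun k => iter k f x : metric_space d) @ \oo -->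
           (xs : metric_space d)].

Definition lyapunov_stable (xs : X) : Prop :=
  forall e : R, 0 < e -> exists2 delta : R, 0 < delta &
    forall x, d x xs < delta -> forall k, d (iter k f x) xs < e.

Definition locally_attractive (xs : X) : Prop :=
  exists2 eta : R, 0 < eta &
    forall x, d x xs < eta -> region_of_attraction xs x.

Definition equilibrium (xs : X) : Prop := f xs = xs.

Definition asymptotically_stable_equilibrium (xs : X) : Prop :=
  [/\ equilibrium xs, lyapunov_stable xs & locally_attractive xs].

End Equilibria.

Definition deterministic_abstraction (T : Type) (S : transition_system T)
    (Xhat : set (state S)) (kappa : state S -> Xhat) :
    transition_system (state S) :=
  @TransitionSystem (state S) Xhat
    [set xh | exists2 x, init S x & xh = kappa x]
    (fun xh => kappa (trans S (val xh))).

Definition finite_deterministic_abstraction (T : Type)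
    (S : transition_system T) (Shat : transition_system (state S)) : Prop :=
  exists (Xhat : set (state S)) (kappa : state S -> Xhat),
    finite_set Xhat /\ Shat = deterministic_abstraction kappa.

Arguments finite_deterministic_abstraction {T} S Shat.

Definition multiresolution_bisimulation (T : Type) (S : transition_system T)
    (Shat : transition_system (state S))
    (Rbar : set (state S * state S)) (rel : set (state S * state Shat)) :
    Prop :=
  [/\ forall x, init S x -> exists2 xh, init Shat xh & rel (x, xh),
      forall x xh, rel (x, xh) -> rel (trans S x, trans Shat xh),
      forall x xh, rel (x, xh) -> Rbar (x, val xh)
    & forall xh, init Shat xh -> exists2 x, init S x & rel (x, xh)].

Arguments multiresolution_bisimulation {T} S Shat Rbar rel.

Definition resolution_relation (R : realType) (X : choiceType) (d : metric R X)
    (eps : X -> R) : set (X * X) :=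
  [set p | d p.1 p.2 <= eps p.2].

(* Main.v *)
(* The quantiser sends every state within [r] of the equilibrium [xs] to [xs],
   and fixes the other points of a finite set made of [xs] and initial segments
   of orbits long enough to reach the [r]-ball. An abstract orbit then is an
   exact orbit of the system until it enters the ball and stays at [xs]
   afterwards, so only finitely many values of the resolution matter on it: the
   incremental bound keeps nearby orbits close before the entrance, Lyapunov
   stability does so after it. Compactness makes finitely many orbits enough.
   The relation is the largest candidate, "the two orbits stay within the
   resolution forever", so that its invariance is immediate. *)
Require Import Defs.
From HB Require Import structures.
From mathcomp Require Import all_boot all_order all_algebra.
From mathcomp Require Import all_classical all_reals all_analysis.
From mathcomp Require Import finmap.

Import Order.TTheory GRing.Theory Num.Theory.
Import numFieldNormedType.Exports.
Set Implicit Arguments.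
Unset Strict Implicit.
Unset Printing Implicit Defensive.

Local Open Scope classical_set_scope.
Local Open Scope ring_scope.

Lemma metric_ge0 (R : realType) (X : choiceType) (d : metric R X) (x y : X) :
  0 <= d x y.
Proof. exact: (@mdist_ge0 _ (metric_space d)). Qed.

(** The interiors of the balls with centre [p] and radius [rho p] form an open cover of [A], even
    though the radius varies with the centre. *)
Lemma compact_finite_net (R : realType) (X : choiceType) (d : metric R X)
    (A : set X) (rho : X -> R) :
  compact_for d A -> (forall x, 0 < rho x) ->
  exists s : seq X, forall x, A x -> exists2 p, p \in s & d p x < rho p.
Proof.
move=> cA rho0; have [A0|[x0 _]] : A = set0 \/ A !=set0.
- by have [->|/set0P] := eqVneq A set0; [left | right].
- by exists [::]; rewrite A0.
pose T : ptopologicalType :=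
  HB.pack_for ptopologicalType (metric_space d) (isPointed.Build (metric_space d) x0).
have : @compact T A by [].
rewrite compact_cover => /(_ X setT (fun p => (ball (p : metric_space d) (rho p))°)).
case.
- by move=> p _; exact: (@open_interior (metric_space d)).
- by move=> x Ax; exists x => //; exact: nbhsx_ballx.
move=> D _ DA; exists (enum_fset D) => x /DA[p /= Dp] /interior_subset.
by exists p.
Qed.

Lemma class_K_lt_near0 (R : realType) (alpha : R -> R) (e : R) :
  class_K alpha -> 0 < e ->
  exists2 r, 0 < r & forall t, 0 <= t < r -> alpha t < e.
Proof.
move=> [/continuous_within_itvcyP[_ ca] _ a0] e0.
move: ca; rewrite a0 => /cvgrPdist_lt /(_ e e0) [r /= r0 ar].
exists r => // t /andP[]; rewrite le_eqVlt => /predU1P[<- _|t0 tr].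
  by rewrite a0.
have := ar t; rewrite /= !sub0r !normrN => art.
by apply: le_lt_trans (ler_norm _) (art _ t0); rewrite gtr0_norm.
Qed.

Lemma iter_near_equilibrium (R : realType) (X : choiceType) (d : metric R X)
    (f : X -> X) (xs : X) (r : R) (x : X) :
  0 < r -> region_of_attraction d f xs x -> exists N, d (iter N f x) xs < r.
Proof.
move=> r0 /metricType_numDomainType.cvgrPdist_lt /(_ r r0) [N _ Nr].
by exists N; rewrite dist_sym; exact: Nr (leqnn N).
Qed.

(** Here [g] is the quantiser seen as a self-map. Induction on [N]: outside the ball [g] fixes [y],
    so the abstract orbit moves on to [g (f y)], and the claim recurs for [f x] and [f y] with one
    step fewer. *)
Lemma quantised_orbit_close (R : realType) (X : choiceType) (d : metric R X)
    (f g : X -> X) (xs : X) (eps : X -> R) (r : R) (Y : set X)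
    (fxs : f xs = xs)
    (xs_stable : forall x, d x xs < r + r -> forall k, d (iter k f x) xs <= eps xs)
    (g_near : forall y, d y xs < r -> g y = xs)
    (g_id : forall y, r <= d y xs -> Y y -> g y = y)
    (r_gt0 : 0 < r) (N : nat) (x y : X) :
  d (iter N f y) xs < r ->
  (forall k, (k <= N)%N -> Y (iter k f y)) ->
  (forall k, (k <= N)%N ->
     d (iter k f x) (iter k f y) < Num.min r (eps (iter k f y))) ->
  forall k, d (iter k f x) (iter k (g \o f) (g y)) <=
            eps (iter k (g \o f) (g y)).
Proof.
have gxs k : iter k (g \o f) xs = xs.
  by apply: iter_fix; rewrite /= fxs g_near// distxx.
(* Once [y'] is in the ball the abstract orbit rests at [xs], while [x'] is within [r + r] of [xs],
   where stability applies. *)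
have close_near x' y' k : d y' xs < r -> d x' y' < Num.min r (eps y') ->
    d (iter k f x') (iter k (g \o f) (g y')) <=
    eps (iter k (g \o f) (g y')).
  rewrite lt_min => yr /andP[xyr _]; rewrite g_near// gxs xs_stable//.
  by rewrite (le_lt_trans (dist_triangle d y' x' xs))// ltrD.
elim: N x y => [|N IH] x y yN yY xy k; first exact: close_near yN (xy 0%N _).
have [yr|ry] := ltP (d y xs) r; first exact: close_near yr (xy 0%N _).
rewrite g_id//; last exact: (yY 0%N).
case: k => [|k].
  by have := xy 0%N isT; rewrite lt_min => /andP[_ /ltW].
rewrite !iterSr; apply: IH => [|j jN|j jN]; rewrite -!iterSr//.
- exact: yY.
- exact: xy.
Qed.

Theorem theorem2 (R : realType) (n : nat) (S : transition_system 'rV[R]_n)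
    (d : metric R (state S)) (xs : state S)
    (init_all : init S = [set: state S])
    (S_dUB : incrementally_uniformly_bounded S d)
    (xs_stable : asymptotically_stable_equilibrium d (trans S) xs)
    (X_compact : compact_for d [set: state S])
    (X_attracted : [set: state S] `<=` region_of_attraction d (trans S) xs)
    (eps : state S -> R) (eps_gt0 : forall x, 0 < eps x) :
  exists (Shat : transition_system (state S))
         (rel : set (state S * state Shat)),
    finite_deterministic_abstraction S Shat /\
    multiresolution_bisimulation S Shat (resolution_relation d eps) rel.
Proof.
case: S_dUB => alpha alphaK; rewrite init_all => dUB.
case: xs_stable => fxs /(_ _ (eps_gt0 xs)) [delta delta0 stable] _.
(* Half of [delta], so that a point within [r] of the [r]-ball is still in the stability ball. *)
pose f := trans S; pose r := delta / 2.
have r0 : 0 < r by rewrite divr_gt0.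
have attr x : d x xs < r + r -> forall k, d (iter k f x) xs <= eps xs.
  by rewrite -splitr => xd k; apply/ltW/stable.
have /choice[N pN] p : exists N, d (iter N f p) xs < r.
  by apply: iter_near_equilibrium => //; exact: X_attracted.
have /choice[rho rhoP] p : exists rho, 0 < rho /\
    forall x, d p x < rho -> forall k, (k <= N p)%N ->
      d (iter k f x) (iter k f p) < Num.min r (eps (iter k f p)).
  (* A minimum of finitely many positive resolutions, capped by the default [r]; [alpha] stays below
     it near 0. *)
  pose m := \big[Num.min/r]_(k < (N p).+1) eps (iter k f p).
  have m0 : 0 < m by apply: lt_bigmin.
  have [rho rho0 alpha_lt] := class_K_lt_near0 alphaK m0.
  exists rho; split=> // x px k kN.
  apply: le_lt_trans (dUB x p I I k) _; apply: lt_le_trans (alpha_lt _ _) _.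
    by rewrite metric_ge0 dist_sym.
  rewrite le_min bigmin_le_id /=.
  exact: (bigmin_le _ (Ordinal (kN : (k < (N p).+1)%N))).
have [s s_net] := compact_finite_net X_compact (fun p => (rhoP p).1).
pose orbits := [seq iter k f p | p <- s, k <- iota 0 (N p).+1].
pose Xhat : set (state S) := [set` xs :: orbits].
have Xhat_iter p k : p \in s -> (k <= N p)%N -> Xhat (iter k f p).
  move=> ps kN; rewrite /Xhat /= inE; apply/orP; right.
  by apply/allpairsPdep; exists p, k; rewrite mem_iota.
(* The point at time [j] on the orbit of [p] reaches the ball after the remaining [N p - j]
   steps. *)
have Xhat_orbit y : Xhat y -> exists2 M, d (iter M f y) xs < r &
    forall k, (k <= M)%N -> Xhat (iter k f y).
  rewrite /Xhat /= inE => /predU1P[->|/allpairsPdep[p [j [ps]]]].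
    exists 0%N; rewrite ?distxx// => k; rewrite leqn0 => /eqP->.
    exact: mem_head.
  rewrite mem_iota add0n ltnS /= => jN ->.
  exists (N p - j)%N; first by rewrite -iterD subnK.
  move=> k kM; rewrite -iterD; apply: Xhat_iter => //.
  by move: kM; rewrite leq_subRL // addnC.
have Xhat_xs : Xhat xs by rewrite /Xhat /= mem_head.
(* A point outside both the ball and [Xhat] gets the default [xs]; abstract orbits from initial
   states never quantise such a point. *)
pose kappa y : Xhat :=
  insubd (SigSub (mem_set Xhat_xs) : Xhat) (if d y xs < r then xs else y).
pose g y : state S := val (kappa y).
have g_near y : d y xs < r -> g y = xs.
  by rewrite /g /kappa val_insubd => ->; rewrite (mem_set Xhat_xs).
have g_id y : r <= d y xs -> Xhat y -> g y = y.
  by rewrite /g /kappa val_insubd leNgt => /negbTE-> /mem_set ->.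
have g_xs : g xs = xs by rewrite g_near// distxx.
have g_idem y : g (g y) = g y.
  suff [->//|gy] : g y = xs \/ g y = y; first by rewrite !gy.
  rewrite /g /kappa val_insubd; case: ifP => _; last by left.
  by case: ifP => _; [left|right].
pose Shat := deterministic_abstraction kappa.
have iter_hat k (xh : Xhat) :
    val (iter k (trans Shat) xh) = iter k (g \o f) (val xh).
  by elim: k => //= k ->.
have shadow := quantised_orbit_close fxs attr g_near g_id r0.
exists Shat, [set p | forall k,
  d (iter k f p.1) (val (iter k (trans Shat) p.2)) <=
  eps (val (iter k (trans Shat) p.2))].
split; first by exists Xhat, kappa; split => //; exact: finite_seq.
split.
- move=> x _; have [p ps px] := s_net x I.
  (* The partner of [x] comes from its net point, since [kappa x] may be the default [xs]. *)
  exists (kappa p); first by exists p; rewrite ?init_all.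
  move=> k; rewrite iter_hat; apply: shadow (pN p) _ _ k => k kN.
    exact: Xhat_iter.
  exact: (rhoP p).2.
- by move=> x xh xxh k; have := xxh k.+1; rewrite !iterSr.
- by move=> x xh /(_ 0%N).
move=> _ [y _ ->]; exists (g y); first by rewrite init_all.
have [M gyM Xhat_gy] := Xhat_orbit _ (set_valP (kappa y)).
(* [shadow] is about abstract orbits started at a value of [g] on the comparison point, here [g y]
   itself, so [g y] is read as [g (g y)]. *)
move=> k; rewrite iter_hat -/(g y) -[X in iter k (g \o f) X]g_idem.
apply: shadow gyM Xhat_gy _ k => k _.
by rewrite distxx lt_min r0 eps_gt0.
Qed.
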